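(* Assume that, for all $i\in T$, $\|\rho_i\|:=\sup_{x_i,z_i\in\mathsf{X}_i}\rho_i(x_i,z_i)<\infty$. For each $i\in\{1,\dots,n+1\}$, let $V^{(i)}$ be a Wasserstein matrix for the Markov kernel $K^{(i)}$ associated with the probability measure $\mu$ on $\mathsf{X}$. Define the matrix $\Gamma=(\Gamma_{ij})_{i,j\in T}$ with entries $$\Gamma_{ij}:=\|\rho_i\|\,V^{(i+1)}_{ij}.$$ Then, for any measurable $f:\mathsf{X}\to\mathbb{R}$ that is Lipschitz with respect to $\rho$ and for any $t\ge 0$, $$\mathbb{P}_\mu\Big\{|f(X)-\mathbb{E}_\mu[f(X)]|\ge t\Big\}\le 2\exp\left(-\frac{2t^2}{\|\Gamma\boldsymbol{\delta}(f)\|^2_{\ell^2(T)}}\right).$$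
   Context: Let $T=\{1,\dots,n\}$, $[i]=\{1,\dots,i\}$ (with $[0]=\varnothing$), $[i,n]=\{i,\dots,n\}$. For each $i\in T$, $\mathsf{X}_i$ is a Polish space with Borel $\sigma$-field $\mathcal{B}_i$ and a metric $\rho_i$ on $\mathsf{X}_i$ that is $\mathcal{B}_i\otimes\mathcal{B}_i$-measurable (not necessarily the one metrizing the topology). For $I\subseteq T$, $\mathsf{X}^I=\prod_{i\in I}\mathsf{X}_i$ with the product $\sigma$-field; $\mathsf{X}=\mathsf{X}^T$ carries the $\sigma$-field $\mathcal{B}$ and the metric $\rho(x,z)=\sum_{i\in T}\rho_i(x_i,z_i)$. $x^I$ denotes the restriction of $x$ to the coordinates in $I$. $\mu$ is a Borel probability measure on $\mathsf{X}$, $X=(X_i)_{i\in T}$ is a random element of $\mathsf{X}$ with law $\mu$, and $\mu^I(dx^I|x^J)$ is the regular conditional law of $X^I$ given $X^J=x^J$ (a fixed version). For $i\in T$, the Markov kernel $K^{(i)}$ on $\mathsf{X}$ is $$K^{(i)}(x,dy)=\delta_{x^{[i-1]}}(dy^{[i-1]})\otimes\mu^{[i,n]}(dy^{[i,n]}|x^{[i-1]}),$$ where $\delta_{x^{[i-1]}}$ is a point mass (so $K^{(i)}f(x)=\mathbb{E}_\mu[f(X)|X^{[i-1]}=x^{[i-1]}]$ and $K^{(1)}f=\mathbb{E}_\mu f$), and $K^{(n+1)}(x,dy)=\delta_x(dy)$. For a kernel $K$, $Kf(x)=\int f(y)K(x,dy)$. The local oscillation of a measurable $f:\mathsf{X}\to\mathbb{R}$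 at $i$ is $$\delta_i(f)=\sup_{x,z\in\mathsf{X}:\ x^{T\setminus\{i\}}=z^{T\setminus\{i\}}}\frac{|f(x)-f(z)|}{\rho_i(x_i,z_i)},\qquad 0/0=0,$$ and $\boldsymbol{\delta}(f)=(\delta_i(f))_{i\in T}$. A nonnegative matrix $V=(V_{ij})_{i,j\in T}$ is a Wasserstein matrix for a Markov kernel $K$ if $\delta_i(Kf)\le\sum_{j\in T}V_{ij}\delta_j(f)$ for every $i\in T$ and every measurable $f$ that is Lipschitz with respect to $\rho$. *)

(* Defs.v *)
From HB Require Import structures.
From mathcomp Require Import all_boot all_order all_algebra.
From mathcomp Require Import all_classical all_reals all_analysis.
From mathcomp Require Import measurable_realfun.

Set Implicit Arguments.
Unset Strict Implicit.
Unset Printing Implicit Defensive.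

Import Order.TTheory GRing.Theory Num.Theory.
Import numFieldNormedType.Exports.

Local Open Scope classical_set_scope.
Local Open Scope ring_scope.

Definition is_metric (R : realType) (S : Type) (d : S -> S -> R) : Prop :=
  [/\ forall x y, d x y = 0 <-> x = y,
      forall x y, d x y = d y x &
      forall x y z, d x z <= d x y + d y z].

Definition polish (R : realType) (S : topologicalType) : Prop :=
  (exists2 D : set S, countable D & dense D) /\
  exists d : S -> S -> R,
    [/\ is_metric d,
        forall x : S, nbhs x =
          filter_from [set e : R | 0 < e] (fun e => [set y | d x y < e]) &
        forall u : nat -> S,
          (forall e : R, 0 < e -> exists N : nat, forall k m : nat,
             (N <= k)%N -> (N <= m)%N -> d (u k) (u m) < e) ->
          exists l : S, u @ \oo --> l].

Definition borel (S : ptopologicalType) := g_sigma_algebraType (@open S).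

(* [ptopologicalType] rather than [topologicalType] because a
   [measurableType] must be pointed; a factor of a space that carries a
   probability measure is nonempty anyway. *)
Definition cylinders (I : Type) (X : I -> ptopologicalType) :
    set (set (forall i, X i)) :=
  \bigcup_i preimage_set_system setT (fun x => x i : borel (X i)) measurable.

Definition prodspace (I : Type) (X : I -> ptopologicalType) :=
  g_sigma_algebraType (@cylinders I X).

Definition subprod (n : nat) (X : 'I_n -> ptopologicalType)
    (I : {set 'I_n}) :=
  prodspace (fun i : {i : 'I_n | i \in I} => X (val i)).

Section prodspace_measurability.
Context (I : Type) (X : I -> ptopologicalType).

Lemma measurable_coord (i : I) :
  measurable_fun [set: prodspace X] (fun x => x i : borel (X i)).
Proof.
by move=> _ B mB; apply: sub_sigma_algebra; exists i => //; exists B.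
Qed.

Lemma measurable_prodspaceP d (S : measurableType d) (g : S -> prodspace X) :
  (forall i, measurable_fun [set: S] (fun s => g s i : borel (X i))) ->
  measurable_fun [set: S] g.
Proof.
move=> mg; apply: (@measurability _ _ _ _ setT g (@cylinders I X)) => //.
move=> _ [A [i _ [B mB <-]] <-].
by rewrite setTI; have := mg i measurableT B mB.
Qed.

End prodspace_measurability.

Section coordinates.
Context (n : nat) (X : 'I_n -> ptopologicalType).

Definition restr (J : {set 'I_n}) (x : prodspace X) : subprod X J :=
  fun j => x (val j).

(* The point with coordinates [y] on [I] and those of [x] outside [I]. *)
Definition glue (I : {set 'I_n}) (x : prodspace X) (y : subprod X I) :
    prodspace X :=
  fun j => match @idP (j \in I) with
           | ReflectT jI => y (exist _ j jI)
           | ReflectF _ => x j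
           end.

Lemma measurable_restr (J : {set 'I_n}) :
  measurable_fun [set: prodspace X] (@restr J).
Proof.
by apply: measurable_prodspaceP => j; exact: (@measurable_coord _ X (val j)).
Qed.

Lemma measurable_glue2 (I : {set 'I_n}) :
  measurable_fun [set: prodspace X * subprod X I]
    (fun xy => @glue I xy.1 xy.2).
Proof.
apply: measurable_prodspaceP => j; rewrite /glue.
case: {-}_ / (@idP (j \in I)) => [jI|_].
- exact: (measurableT_comp
    (@measurable_coord _ (fun i : {i : 'I_n | i \in I} => X (val i))
       (exist _ j jI)) measurable_snd).
- exact: (measurableT_comp (@measurable_coord _ X j) measurable_fst).
Qed.

Lemma measurable_glue (I : {set 'I_n}) (x : prodspace X) :
  measurable_fun [set: subprod X I] (@glue I x).
Proof.
exact: (measurableT_comp (@measurable_glue2 I) (pair1_measurable x)).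
Qed.

End coordinates.

Arguments restr {n X} J x.
Arguments glue {n X} I x y.

(* [kappa a] is a version of the regular conditional law of the coordinates
   in [I] given that those in [J] equal [a], under the law [mu]. *)
Definition cond_law (R : realType) (n : nat) (X : 'I_n -> ptopologicalType)
    (mu : probability (prodspace X) R) (I J : {set 'I_n})
    (kappa : R.-pker subprod X J ~> subprod X I) : Prop :=
  forall (A : set (subprod X J)) (B : set (subprod X I)),
    measurable A -> measurable B ->
    mu (restr J @^-1` A `&` restr I @^-1` B) =
    (\int[mu]_(x in restr J @^-1` A) kappa (restr J x) B)%E.

Section freeze.
Context (R : realType) (n : nat) (X : 'I_n -> ptopologicalType).
Context (I J : {set 'I_n}) (kappa : R.-pker subprod X J ~> subprod X I).

(* The law of the point whose coordinates in [I] are drawn from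
   [kappa (restr J x)], the other coordinates being those of [x]; when [J] is
   the complement of [I], this is the product of the point mass at
   [restr J x] and of [kappa (restr J x)]. *)
Definition freeze (x : prodspace X) : set (prodspace X) -> \bar R :=
  pushforward (kappa (restr J x)) (glue I x).

Let measurable_glue_preimage (x : prodspace X) B : measurable B ->
  measurable (glue I x @^-1` B).
Proof.
by move=> mB; have := @measurable_glue n X I x measurableT B mB; rewrite setTI.
Qed.

Let freeze0 x : freeze x set0 = 0%E.
Proof. by rewrite /freeze /pushforward preimage_set0 measure0. Qed.

Let freeze_ge0 x A : (0 <= freeze x A)%E.
Proof. by rewrite /freeze /pushforward; exact: measure_ge0. Qed.

Let freeze_sigma_additive x : semi_sigma_additive (freeze x).
Proof.
move=> F mF tF mUF; rewrite /freeze /pushforward preimage_bigcup.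
apply: measure_semi_sigma_additive.
- by move=> k; exact: measurable_glue_preimage.
- apply/trivIsetP => /= k m _ _ km; rewrite -preimage_setI.
  by move/trivIsetP : tF => /(_ _ _ _ _ km) ->//; rewrite preimage_set0.
- by rewrite -preimage_bigcup; exact: measurable_glue_preimage.
Qed.

HB.instance Definition _ x := isMeasure.Build _ _ _ (freeze x)
  (freeze0 x) (freeze_ge0 x) (@freeze_sigma_additive x).

Definition kfreeze : prodspace X -> {measure set (prodspace X) -> \bar R} :=
  freeze.

Let kpast : prodspace X -> {measure set (subprod X I) -> \bar R} :=
  fun x => kappa (restr J x).

Let measurable_kpast U : measurable U ->
  measurable_fun [set: prodspace X] (kpast ^~ U).
Proof.
move=> mU.
exact: (measurableT_comp (measurable_kernel kappa U mU)
  (@measurable_restr n X J)).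
Qed.

HB.instance Definition _ := isKernel.Build _ _ _ _ _ kpast measurable_kpast.

Let kpast_prob x : kpast x [set: subprod X I] = 1%E.
Proof. exact: prob_kernel. Qed.

HB.instance Definition _ := Kernel_isProbability.Build _ _ _ _ _
  kpast kpast_prob.

Let measurable_kfreeze U : measurable U ->
  measurable_fun [set: prodspace X] (kfreeze ^~ U).
Proof.
move=> mU.
pose A := (fun xy : prodspace X * subprod X I => glue I xy.1 xy.2) @^-1` U.
have mA : measurable A.
  by have := @measurable_glue2 n X I measurableT U mU; rewrite setTI.
rewrite (_ : kfreeze ^~ U = fun x => kpast x (xsection A x)).
  by apply: measurable_fun_xsection_finite_kernel; rewrite inE.
apply/funext => x; rewrite /kfreeze/= /freeze /pushforward; congr (kpast x _).
by apply/seteqP; split => y; rewrite /xsection /A /= inE.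
Qed.

HB.instance Definition _ := isKernel.Build _ _ _ _ _ kfreeze
  measurable_kfreeze.

Let kfreeze_prob x : kfreeze x [set: prodspace X] = 1%E.
Proof. exact: prob_kernel. Qed.

HB.instance Definition _ := Kernel_isProbability.Build _ _ _ _ _
  kfreeze kfreeze_prob.

End freeze.

Section martingale_kernel.
Context (R : realType) (n : nat) (X : 'I_n -> ptopologicalType).

(* Coordinates are numbered from 0, so [past i] and [future i] are the sets
   [{1, .., i}] and [{i + 1, .., n}] of 1-based coordinates. *)
Definition past (i : 'I_n) : {set 'I_n} := [set j : 'I_n | (j < i)%N]%SET.
Definition future (i : 'I_n) : {set 'I_n} := [set j : 'I_n | (i <= j)%N]%SET.

(* The kernel of index [i + 1] in 1-based numbering; the last one is the
   identity kernel. *)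
Definition mart_kernel
    (kappa : forall i : 'I_n, R.-pker subprod X (past i) ~> subprod X (future i))
    (i : 'I_n.+1) : R.-pker prodspace X ~> prodspace X :=
  match unlift ord_max i with
  | Some j => kfreeze (kappa j)
  | None => kdirac (@measurable_id _ (prodspace X) setT)
  end.

End martingale_kernel.

Section wasserstein.
Context (R : realType) (n : nat) (X : 'I_n -> ptopologicalType).
Context (rho : forall i, X i -> X i -> R).

Definition rho_norm (i : 'I_n) : \bar R :=
  ereal_sup [set (rho xz.1 xz.2)%:E | xz in [set: X i * X i]].

Definition rho_sum (x z : prodspace X) : R := \sum_(i < n) rho (x i) (z i).

Definition rho_lipschitz (f : prodspace X -> R) : Prop :=
  exists L : R, forall x z, `|f x - f z| <= L * rho_sum x z.

(* When [x = z] the ratio is [0 / 0 = 0]. *)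
Definition local_osc (f : prodspace X -> R) (i : 'I_n) : \bar R :=
  ereal_sup [set (`|f xz.1 - f xz.2| / rho (xz.1 i) (xz.2 i))%:E | xz in
    [set xz : prodspace X * prodspace X |
      forall j, j != i -> xz.1 j = xz.2 j]].

Definition kernel_fun (K : R.-pker prodspace X ~> prodspace X)
    (f : prodspace X -> R) (x : prodspace X) : R :=
  \int[K x]_y f y.

Definition wasserstein_matrix (K : R.-pker prodspace X ~> prodspace X)
    (V : 'M[R]_n) : Prop :=
  (forall i j, 0 <= V i j) /\
  forall f : prodspace X -> R,
    measurable_fun [set: prodspace X] f -> rho_lipschitz f ->
    forall i : 'I_n,
      (local_osc (kernel_fun K f) i <=
       \sum_(j < n) (V i j)%:E * local_osc f j)%E.

Definition Gamma (V : 'I_n.+1 -> 'M[R]_n) (i j : 'I_n) : \bar R :=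
  (rho_norm i * (V (lift ord0 i) i j)%:E)%E.

Definition mulmxv (A : 'I_n -> 'I_n -> \bar R) (v : 'I_n -> \bar R) :
  'I_n -> \bar R := fun i => (\sum_(j < n) A i j * v j)%E.

Definition l2norm_sq (v : 'I_n -> \bar R) : \bar R :=
  (\sum_(i < n) v i ^+ 2)%E.

End wasserstein.

(* Main.v *)
Require Import Defs.
From HB Require Import structures.
From mathcomp Require Import all_boot all_order all_algebra.
From mathcomp Require Import all_classical all_reals all_analysis.
From mathcomp Require Import measurable_realfun.
From mathcomp Require Import ring lra.

(* Write g_i = K^(i+1) f, so that g_0 = E f and g_n = f. The kernel K^(i+1)
   preserves mu, freezes the first i coordinates, and K^(i+1) g_(i+1) = g_i
   mu-almost everywhere; hence g_0, .., g_n is a martingale. Given the first i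
   coordinates, g_(i+1) depends on the next one only, so the Wasserstein
   inequality confines it to an interval of length (Gamma delta(f))_i. Peeling
   off one kernel at a time with Hoeffding's lemma bounds the moment generating
   function of f - E f, and Chernoff's inequality concludes. *)

Set Implicit Arguments.
Unset Strict Implicit.
Unset Printing Implicit Defensive.

Import Order.TTheory GRing.Theory Num.Theory.
Import numFieldNormedType.Exports.

Local Open Scope classical_set_scope.
Local Open Scope ring_scope.

(* MathComp-Analysis also has a [glue], which shadows that of [Defs]. *)
Local Notation glue := Defs.glue.

(** * The moment generating function of a two-point law *)

Lemma is_derive_ge0_le (R : realType) (f df : R -> R) (u : R) :
  (forall x : R, is_derive x 1 f (df x)) -> (forall x, 0 <= x -> 0 <= df x) ->
  0 <= u -> f 0 <= f u.
Proof.
move=> fdf df0 u0; rewrite -subr_ge0.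
have [|c /[!in_itv]/= /andP[c0 _] ->] := MVT_segment u0 (fun x _ => fdf x).
  by apply: derivable_within_continuous => x _; exact: ex_derive.
by rewrite mulr_ge0 ?subr_ge0 ?df0.
Qed.

(** The left side is the moment generating function at [u] of a centred Bernoulli variable of
    parameter [p]. Its logarithm vanishes to first order at 0 and has second derivative at most 1/4;
    two uses of [is_derive_ge0_le] turn this into [u^2 / 8]. *)
Lemma bernoulli_mgf_le (R : realType) (p u : R) : 0 <= p <= 1 ->
  (1 - p) * expR (- (p * u)) + p * expR ((1 - p) * u) <= expR (u ^+ 2 / 8).
Proof.
(* Swapping [p] with [1 - p] and [u] with [- u] exchanges the two terms. *)
wlog u0 : p u / 0 <= u => [wlg p01|/andP[p0 p1]].
  have [u0|/ltW u0] := leP 0 u; first exact: wlg.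
  have := wlg (1 - p) (- u); rewrite oppr_ge0 => /(_ u0).
  rewrite sqrrN subKr !mulrN opprK => h; rewrite addrC; apply: h.
  by move: p01 => /andP[p0 p1]; rewrite subr_ge0 p1/= lerBlDr lerDl.
pose D (x : R) := 1 - p + p * expR x.
have D0 x : 0 < D x.
  rewrite /D; have := expR_gt0 x; have [->|] := eqVneq p 0.
    by move=> _; rewrite mul0r addr0 subr0.
  by move=> pN0 ex; rewrite ltr_wpDl ?subr_ge0// mulr_gt0// lt_def pN0.
have dD (x : R) : is_derive x 1 D (p * expR x).
  have dE : is_derive x 1 (cst (1 - p) + p \*: expR) (0 + p *: expR x).
    exact: is_deriveD.
  by move: dE; rewrite add0r.
have dlnD (x : R) : is_derive x 1 (fun x => ln (D x)) (p * expR x / D x).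
  by rewrite mulrC; apply: is_derive1_comp; exact: is_derive1_ln.
have dinvD (x : R) :
    is_derive x 1 (fun x => (D x)^-1) (- (D x) ^- 2 * (p * expR x)).
  exact: (@is_deriveV _ D x _ _ (lt0r_neq0 (D0 x)) (dD x)).
(* phi is the derivative of psi (x) = x^2 / 8 + p x - ln (1 - p + p e^x), and
   phi' >= 0 by AM-GM. *)
pose phi (x : R) := x / 4 + p - p * expR x / D x.
have dphi (x : R) :
    is_derive x 1 phi (4^-1 - (1 - p) * (p * expR x) / D x ^+ 2).
  (* Since [p e^x / D x = 1 - (1 - p) / D x], only the inverse of [D] has to be differentiated. *)
  pose h := (4^-1 \*: @id R) + cst (p - 1) + (1 - p) \*: (fun x => (D x)^-1).
  have -> : phi = h.
    apply/funext => y; rewrite /phi /h !fctE /=.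
    have := D0 y; rewrite /D => Dy; rewrite /GRing.scale/=; field.
    by rewrite -/(D y) lt0r_neq0.
  have : is_derive x 1 h (4^-1 *: (1 : R) + 0 +
      (1 - p) *: (- (D x) ^- 2 * (p * expR x))).
    exact: is_deriveD.
  rewrite /GRing.scale/= mulr1 addr0 mulNr mulrN.
  by rewrite [X in _ - X]mulrA [X in _ - X]mulrAC.
have phi0 x : 0 <= x -> 0 <= phi x.
  move=> x0; have -> : 0 = phi 0.
    by rewrite /phi /D expR0 mul0r !mulr1 subrK divr1 add0r subrr.
  apply: is_derive_ge0_le dphi _ x0 => y _.
  rewrite subr_ge0 ler_pdivrMr ?exprn_gt0//.
  by rewrite /D; set e := p * _; have := sqr_ge0 (1 - p - e); nra.
pose psi (x : R) := x ^+ 2 / 8 + p * x - ln (D x).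
have dpsi (x : R) : is_derive x 1 psi (phi x).
  pose h := 8^-1 \*: (@id R ^+ 2) + p \*: @id R - (fun x => ln (D x)).
  have -> : psi = h.
    by apply/funext => y; rewrite /psi /h !fctE /GRing.scale/= mulrC.
  have : is_derive x 1 h (8^-1 *: ((2%:R * id x ^+ 2.-1) *: (1 : R)) +
      p *: (1 : R) - p * expR x / D x).
    exact: is_deriveB.
  rewrite /GRing.scale/= expr1 !mulr1 /phi.
  by have -> : 8^-1 * (2 * x) = x / 4 by field.
(* [psi 0 = 0] because [D 0 = 1]; exponentiating [0 <= psi u] and dividing by [exp (p u)] gives the
   claim. *)
have := is_derive_ge0_le dpsi phi0 u0.
rewrite /psi expr0n/= mul0r mulr0 !add0r {1}/D expR0 mulr1 subrK ln1 oppr0.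
rewrite subr_ge0 -ler_expR lnK ?posrE// expRD.
rewrite -ler_pdivrMr ?expR_gt0//; apply: le_trans.
rewrite -expRN /D [leRHS]mulrDl -[in leRHS]mulrA -expRD.
by rewrite [(1 - p) * u]mulrBl mul1r.
Qed.

(** * Bounded measurable functions, integrable for every probability, and Hoeffding's lemma *)

Definition bounded_measurable d (T : measurableType d) (R : realType)
    (f : T -> R) : Prop :=
  measurable_fun [set: T] f /\ exists M, forall x, `|f x| <= M.

Section bounded_measurable.
Context d (T : measurableType d) (R : realType).
Implicit Types f g : T -> R.

Lemma bounded_measurable_cst (r : R) : bounded_measurable (fun _ : T => r).
Proof. by split; [exact: measurable_cst|exists `|r|]. Qed.

Lemma bounded_measurableD f g : bounded_measurable f -> bounded_measurable g ->
  bounded_measurable (fun x => f x + g x).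
Proof.
move=> [mf [M fM]] [mg [N gN]]; split; first exact: measurable_funD.
by exists (M + N) => x; rewrite (le_trans (ler_normD _ _))// lerD.
Qed.

Lemma bounded_measurableM f g : bounded_measurable f -> bounded_measurable g ->
  bounded_measurable (fun x => f x * g x).
Proof.
move=> [mf [M fM]] [mg [N gN]]; split; first exact: measurable_funM.
by exists (M * N) => x; rewrite normrM ler_pM.
Qed.

Lemma bounded_measurableB f g : bounded_measurable f -> bounded_measurable g ->
  bounded_measurable (fun x => f x - g x).
Proof.
move=> bf [mg [N gN]]; apply: bounded_measurableD => //; split.
  exact: measurableT_comp.
by exists N => x; rewrite normrN.
Qed.

Lemma bounded_measurable_expR f : bounded_measurable f ->
  bounded_measurable (fun x => expR (f x)).
Proof.
move=> [mf [M fM]]; split; first exact: measurableT_comp.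
exists (expR M) => x; rewrite ger0_norm ?expR_ge0// ler_expR.
exact: le_trans (ler_norm _) (fM x).
Qed.

Lemma bounded_measurable_exp_centered f (l e : R) : bounded_measurable f ->
  bounded_measurable (fun x => expR (l * (f x - e))).
Proof.
move=> bf; apply: bounded_measurable_expR; apply: bounded_measurableM.
  exact: bounded_measurable_cst.
by apply: bounded_measurableB => //; exact: bounded_measurable_cst.
Qed.

Lemma bounded_measurable_comp d' (S : measurableType d') (h : S -> T) f :
  measurable_fun [set: S] h -> bounded_measurable f ->
  bounded_measurable (fun s => f (h s)).
Proof.
by move=> mh [mf [M fM]]; split; [exact: measurableT_comp|exists M].
Qed.

Lemma measurable_superlevel f (t : R) : measurable_fun [set: T] f ->
  measurable [set x | t <= f x].
Proof.
move=> mf; rewrite [X in measurable X](_ : _ = setT `&` f @^-1` `[t, +oo[).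
  exact: mf.
by rewrite setTI; apply/seteqP; split => x /=; rewrite in_itv/= andbT.
Qed.

(** A measure of total mass 1 rather than a [probability]: the results are applied to [K x] and to
    [mixture], which are typed as measures. *)
Variables (m : {measure set T -> \bar R}) (m1 : m [set: T] = 1%E).

Lemma bounded_measurable_integrable f : bounded_measurable f ->
  m.-integrable [set: T] (EFin \o f).
Proof.
move=> [mf [M fM]]; apply: measurable_bounded_integrable => //.
  by rewrite m1 ltry.
exists M; split; first exact: num_real.
by move=> N MN x _ /=; exact/ltW/(le_lt_trans (fM x)).
Qed.

Lemma Rintegral_probability_cst (r : R) : \int[m]_x r = r.
Proof. by rewrite Rintegral_cst//= m1/= mulr1. Qed.

Lemma EFin_Rintegral f : bounded_measurable f ->
  (\int[m]_x f x)%:E = (\int[m]_x (f x)%:E)%E.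
Proof.
move=> /bounded_measurable_integrable bf; rewrite /Rintegral fineK//.
exact: (integrable_fin_num measurableT bf).
Qed.

Lemma ae_eq_Rintegral f g : measurable_fun [set: T] f ->
  measurable_fun [set: T] g ->
  ae_eq m [set: T] (EFin \o f) (EFin \o g) -> \int[m]_x f x = \int[m]_x g x.
Proof.
move=> mf mg fg; congr fine; apply: ae_eq_integral => //;
  exact/measurable_EFinP.
Qed.

Lemma normr_Rintegral_le f M : bounded_measurable f ->
  (forall x, `|f x| <= M) -> `|\int[m]_x f x| <= M.
Proof.
move=> bf fM; have intf := bounded_measurable_integrable bf.
apply: (le_trans (le_normr_Rintegral measurableT intf)).
rewrite -[leRHS]Rintegral_probability_cst; apply: le_Rintegral => //.
  exact: (integrable_norm intf).
exact/bounded_measurable_integrable/bounded_measurable_cst.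
Qed.

(** By convexity the exponential lies below its chord over an interval of length [c] containing the
    values of [f]. The integral of the chord depends on the mean only, and equals the moment
    generating function of a two-point law with that mean, bounded by [bernoulli_mgf_le]. *)
Lemma hoeffding_mgf f (c l : R) : bounded_measurable f ->
  (forall x y, f x - f y <= c) ->
  \int[m]_x expR (l * (f x - \int[m]_y f y)) <= expR (l ^+ 2 * c ^+ 2 / 8).
Proof.
move=> bf fc; set E := \int[m]_y f y.
have intf := bounded_measurable_integrable bf.
have ic := fun r => bounded_measurable_integrable (bounded_measurable_cst r).
have [mf [M fM]] := bf.
(* The oscillation bound places all values of [f] in the interval from [a] to [a + c]. *)
pose a := inf (range f).
have hinf : has_inf (range f).
  split; first by exists (f point), point.
  by exists (- M) => _ [x _ <-]; have := fM x; rewrite ler_norml => /andP[].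
have af x : a <= f x by apply: ge_inf; [case: hinf|exists x].
have fac x : f x <= a + c.
  rewrite -lerBlDr; apply: lb_le_inf; first by case: hinf.
  by move=> _ [y _ <-]; rewrite lerBlDr addrC -lerBlDr; exact: fc.
have aE : a <= E.
  by rewrite -[a]Rintegral_probability_cst; apply: le_Rintegral.
have Eac : E <= a + c.
  by rewrite -[a + c]Rintegral_probability_cst; apply: le_Rintegral.
have : 0 <= c by have := fc point point; rewrite subrr.
(* Zero width makes [f] constant; this case is split off because [p] below divides by [c]. *)
rewrite le_eqVlt => /predU1P[c0|c0].
  have fE x : f x = E.
    by apply/eqP; rewrite eq_le; move: (af x) (fac x); lra.
  under eq_Rintegral do rewrite fE subrr mulr0 expR0.
  by rewrite Rintegral_probability_cst -c0 expr0n mulr0 mul0r expR0.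
set p := (E - a) / c.
have p01 : 0 <= p <= 1.
  by rewrite divr_ge0 ?subr_ge0 ?(ltW c0)//= ler_pdivrMr// mul1r lerBlDl.
rewrite -exprMn; apply: le_trans (bernoulli_mgf_le (l * c) p01).
(* [e1] and [e2] are the values of [exp (l (s - E))] at [s = a] and [s = a + c]; [b] is the slope of
   the chord joining them. *)
set e1 := expR (- _); set e2 := expR (_ * _).
pose b := (e2 - e1) / c.
apply: (@le_trans _ _ (\int[m]_x (e1 - b * a + b * f x))).
  apply: le_Rintegral => //.
  - exact/bounded_measurable_integrable/bounded_measurable_exp_centered.
  - apply/bounded_measurable_integrable.
    apply: bounded_measurableD; first exact: bounded_measurable_cst.
    by apply: bounded_measurableM => //; exact: bounded_measurable_cst.
  move=> x _.
  have q0 : 0 <= (f x - a) / c by rewrite divr_ge0 ?subr_ge0 ?(ltW c0).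
  have q1 : (f x - a) / c <= 1.
    by rewrite ler_pdivrMr// mul1r lerBlDl.
  have := @convex_expR R (Itv01 q0 q1) (l * (a + c - E)) (l * (a - E)).
  rewrite !convRE/= /unstable.onem => h; apply: (le_trans (le_trans _ h)).
    rewrite ler_expR le_eqVlt; apply/orP; left; apply/eqP; field.
    by rewrite gt_eqF.
  rewrite /b /e1 /e2 /p.
  have -> : l * (a + c - E) = (1 - (E - a) / c) * (l * c).
    by field; rewrite gt_eqF.
  have -> : l * (a - E) = - ((E - a) / c * (l * c)) by field; rewrite gt_eqF.
  by rewrite le_eqVlt; apply/orP; left; apply/eqP; field; rewrite gt_eqF.
rewrite RintegralD//; last first.
  apply/bounded_measurable_integrable.
  by apply: bounded_measurableM => //; exact: bounded_measurable_cst.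
rewrite Rintegral_probability_cst RintegralZl// -/E /b /p.
by rewrite le_eqVlt; apply/orP; left; apply/eqP; field; rewrite gt_eqF.
Qed.

End bounded_measurable.

(** * Integrals against Markov kernels and mixtures *)

Section kernel_integral.
Context d d' (T : measurableType d) (T' : measurableType d') (R : realType).
Variable K : R.-pker T ~> T'.

Lemma bounded_measurable_kernel (F : T' -> R) : bounded_measurable F ->
  bounded_measurable (fun x => \int[K x]_y F y).
Proof.
move=> bF; have [mF [M FM]] := bF; split; last first.
  by exists M => x; apply: normr_Rintegral_le => //; exact: prob_kernel.
(* Adding the bound [M] makes the integrand nonnegative, where measurability in [x] is available;
   [M] is subtracted afterwards. *)
have bM := @bounded_measurable_cst _ T' R M.
have bFM := bounded_measurableD bF bM.
have mFM : measurable_fun [set: T] (fun x => \int[K x]_y (F y + M)).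
  apply/measurable_EFinP.
  rewrite (_ : _ \o _ = fun x => (\int[K x]_y (F y + M)%:E)%E); last first.
    by apply/funext => x /=; rewrite EFin_Rintegral//; exact: prob_kernel.
  apply: (measurable_fun_integral_kernel (measurable_kernel K)).
    by move=> y; rewrite lee_fin -lerBlDr sub0r;
      have := FM y; rewrite ler_norml => /andP[].
  by apply/measurable_EFinP; case: bFM.
rewrite (_ : (fun x => _) = fun x => \int[K x]_y (F y + M) - M).
  exact: measurable_funB.
apply/funext => x; have K1 := prob_kernel (s := K) x.
rewrite RintegralD//; [|exact: bounded_measurable_integrable..].
by rewrite Rintegral_probability_cst// addrK.
Qed.

End kernel_integral.

Section mixture.
Context d d' (T : measurableType d) (T' : measurableType d') (R : realType).
Variables (mu : probability T R) (K : R.-pker T ~> T').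

Let kmu : unit -> {measure set T -> \bar R} := fun=> mu.

Let measurable_kmu U : measurable U -> measurable_fun [set: unit] (kmu ^~ U).
Proof. by move=> mU; exact: measurable_cst. Qed.

HB.instance Definition _ := isKernel.Build _ _ _ _ _ kmu measurable_kmu.

Let kmu_prob x : kmu x [set: T] = 1%E.
Proof. exact: probability_setT. Qed.

HB.instance Definition _ := Kernel_isProbability.Build _ _ _ _ _ kmu kmu_prob.

Let Ksnd : unit * T -> {measure set T' -> \bar R} := K \o snd.

Let measurable_Ksnd U : measurable U ->
  measurable_fun [set: unit * T] (Ksnd ^~ U).
Proof.
move=> mU.
exact: (measurableT_comp (measurable_kernel K U mU) measurable_snd).
Qed.

HB.instance Definition _ := isKernel.Build _ _ _ _ _ Ksnd measurable_Ksnd.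

Let Ksnd_prob x : Ksnd x [set: T'] = 1%E.
Proof. exact: prob_kernel. Qed.

HB.instance Definition _ := Kernel_isProbability.Build _ _ _ _ _
  Ksnd Ksnd_prob.

(** The law of a point drawn from [K x] with [x] drawn from [mu]. Viewing [mu] as a kernel from a
    one-point space makes it a composition of kernels, which supplies sigma-additivity and the
    integral formula. *)
Definition mixture : {measure set T' -> \bar R} := mkcomp kmu Ksnd tt.

Lemma mixtureE A : mixture A = (\int[mu]_x K x A)%E.
Proof. by []. Qed.

Lemma mixture_setT : mixture [set: T'] = 1%E.
Proof.
rewrite mixtureE; under eq_integral do rewrite prob_kernel.
by rewrite integral_cst// mul1e; exact: probability_setT.
Qed.

Lemma ge0_integral_mixture (F : T' -> \bar R) : (forall y, 0 <= F y)%E ->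
  measurable_fun [set: T'] F ->
  (\int[mixture]_y F y = \int[mu]_x \int[K x]_y F y)%E.
Proof. by move=> F0 mF; exact: (@integral_kcomp _ _ _ _ _ _ _ kmu Ksnd). Qed.

Lemma Rintegral_mixture (F : T' -> R) : bounded_measurable F ->
  \int[mixture]_y F y = \int[mu]_x \int[K x]_y F y.
Proof.
move=> bF; have [mF [M FM]] := bF; have mu1 := probability_setT mu.
have bM := @bounded_measurable_cst _ T' R M.
have bFM := bounded_measurableD bF bM.
have K1 x := prob_kernel (s := K) x.
(* As for kernels, a shift by [M] reduces to nonnegative integrands. *)
apply: (addIr M).
rewrite -[X in _ + X = _](Rintegral_probability_cst mixture_setT).
rewrite -RintegralD//; [|exact: (bounded_measurable_integrable mixture_setT)..].
rewrite -[X in _ = _ + X](Rintegral_probability_cst mu1) -RintegralD//;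
  last 2 first.
- exact/(bounded_measurable_integrable mu1)/bounded_measurable_kernel.
- exact/(bounded_measurable_integrable mu1)/bounded_measurable_cst.
rewrite /Rintegral ge0_integral_mixture; last 2 first.
- by move=> y; rewrite lee_fin -lerBlDr sub0r;
      have := FM y; rewrite ler_norml => /andP[].
- by apply/measurable_EFinP; case: bFM.
congr fine; apply: eq_integral => x _.
rewrite -EFin_Rintegral// RintegralD//;
  [|exact: bounded_measurable_integrable..].
by rewrite Rintegral_probability_cst.
Qed.

End mixture.

(** * Glued points and the invariance of the law under resampling a block of coordinates *)

Section glue.
Context (n : nat) (X : 'I_n -> ptopologicalType) (I : {set 'I_n}).
Implicit Types (x : prodspace X) (y : subprod X I).

Lemma glue_in x y j (jI : j \in I) : glue I x y j = y (exist _ j jI).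
Proof.
rewrite /glue; case: {-}_ / idP => // jI'.
by congr (y (exist _ _ _)); exact: bool_irrelevance.
Qed.

Lemma glue_notin x y j : j \notin I -> glue I x y j = x j.
Proof. by rewrite /glue; case: {-}_ / idP => // jI; rewrite jI. Qed.

Lemma restr_glue x y : restr I (glue I x y) = y.
Proof. by apply/functional_extensionality_dep => -[j jI]; exact: glue_in. Qed.

Lemma restrC_glue (J : {set 'I_n}) x y : J = ~: I ->
  restr J (glue I x y) = restr J x.
Proof.
move=> ->; apply/functional_extensionality_dep => -[j jI].
by apply: glue_notin; rewrite -finset.in_setC.
Qed.

End glue.

Section kfreeze_lemmas.
Context (R : realType) (n : nat) (X : 'I_n -> ptopologicalType).
Context (I J : {set 'I_n}) (kappa : R.-pker subprod X J ~> subprod X I).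

Lemma Rintegral_kfreeze x (F : prodspace X -> R) : bounded_measurable F ->
  \int[kfreeze kappa x]_y F y =
  \int[kappa (restr J x)]_y F (glue I x y).
Proof.
move=> bF; rewrite /Rintegral; congr fine.
have mg := @measurable_glue n X I x.
have bFg := bounded_measurable_comp mg bF.
rewrite -[LHS]/(\int[pushforward (kappa (restr J x)) (glue I x)]_y (F y)%:E)%E.
rewrite integral_pushforward//.
  by apply/measurable_EFinP; case: bF.
apply: bounded_measurable_integrable bFg; exact: prob_kernel.
Qed.

(** The rectangles in [G] form a pi-system generating the sigma-field, so two measures of finite
    mass that agree on them coincide. On a rectangle the identity is the definition of [cond_law],
    as freezing retains the coordinates in [J]. *)
Lemma mixture_kfreeze (mu : probability (prodspace X) R) : J = ~: I ->
  cond_law mu kappa ->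
  forall A, measurable A -> mixture mu (kfreeze kappa) A = mu A.
Proof.
move=> JI law.
pose G := [set restr J @^-1` A.1 `&` restr I @^-1` A.2 | A in
  [set A : set (subprod X J) * set (subprod X I) |
    measurable A.1 /\ measurable A.2]].
(* Every coordinate lies in [I] or in [J], so a cylinder is a rectangle with one trivial side. *)
have cG : @cylinders _ X `<=` G.
  move=> _ [j _ [B mB <-]]; rewrite setTI.
  have mcoord (L : {set 'I_n}) (jL : j \in L) :
      measurable [set y : subprod X L | B (y (exist _ j jL))].
    have := @measurable_coord _ (fun i : {i : 'I_n | i \in L} => X (val i))
      (exist _ j jL) measurableT B mB.
    by rewrite setTI.
  have [jI|jI] := boolP (j \in I).
    exists (setT, [set y : subprod X I | B (y (exist _ j jI))]).
      by split; [exact: measurableT|exact: (mcoord I jI)].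
    by rewrite preimage_setT setTI.
  have jJ : j \in J by rewrite JI finset.in_setC.
  exists ([set y : subprod X J | B (y (exist _ j jJ))], setT).
    by split; [exact: (mcoord J jJ)|exact: measurableT].
  by rewrite preimage_setT setIT.
have GG A : G A -> exists A1 A2, [/\ measurable A1, measurable A2 &
    A = restr J @^-1` A1 `&` restr I @^-1` A2].
  by move=> [[A1 A2] [/= m1 m2] <-]; exists A1, A2.
apply: (measure_unique G (fun=> setT)).
- apply/seteqP; split; first exact: sub_sigma_algebra2.
  apply: smallest_sub; first exact: sigma_algebra_measurable.
  move=> _ /GG[A [B [mA mB ->]]]; apply: measurableI.
    by rewrite -[X in measurable X]setTI; exact: measurable_restr.
  by rewrite -[X in measurable X]setTI; exact: measurable_restr.
- move=> _ _ /GG[A [B [mA mB ->]]] /GG[A' [B' [mA' mB' ->]]].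
  exists (A `&` A', B `&` B'); first by split; exact: measurableI.
  by rewrite !preimage_setI setIACA.
- by move=> _; exists (setT, setT) => //=; rewrite !preimage_setT setTI.
- by rewrite bigcup_const//; exists 0%N.
- move=> _ /GG[A [B [mA mB ->]]]; apply: (etrans _ (esym (law A B mA mB))).
  rewrite mixtureE.
  rewrite [RHS]integral_mkcond; apply: eq_integral => x _.
  rewrite patchE /kfreeze/= /freeze /pushforward.
  (* Gluing keeps the coordinates of [x] on [J] and installs [y] on [I], so the condition on [J] no
     longer involves [y]. *)
  have -> : glue I x @^-1` (restr J @^-1` A `&` restr I @^-1` B) =
      [set y | A (restr J x) /\ B y].
    by apply/seteqP; split => y; rewrite /= restr_glue (restrC_glue _ _ JI).
  case: ifPn => [/set_mem xA|/negP xA].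
    by congr (kappa _ _); apply/seteqP; split => y //= [].
  rewrite -[RHS](@measure0 _ _ _ (kappa (restr J x))); congr (kappa _ _).
  by apply/seteqP; split => y //= [Ax _]; apply: xA; rewrite inE.
- by move=> _; rewrite mixture_setT ltry.
Qed.

End kfreeze_lemmas.

(** * The martingale kernels: locality, taking out what is known, invariance of the law *)

Section splice.
Context (n : nat) (X : 'I_n -> ptopologicalType).
Implicit Types x y : prodspace X.

(* Replacing y by splice k x y does not change integrals against a kernel that
   freezes the first k coordinates at x. This makes pointwise assumptions
   available without having to measure the set of points that agree with x. *)
Definition splice (k : nat) x y : prodspace X :=
  fun j => if (j < k)%N then x j else y j.

Lemma measurable_splice k x : measurable_fun [set: prodspace X] (splice k x).
Proof.
apply: measurable_prodspaceP => j; rewrite /splice; case: (j < k)%N.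
  exact: measurable_cst.
exact: measurable_coord.
Qed.

Lemma splice_full k x y : (n <= k)%N -> splice k x y = x.
Proof.
move=> nk; apply/functional_extensionality_dep => j.
by rewrite /splice (leq_trans (ltn_ord j) nk).
Qed.

End splice.

Section mart_kernel.
Context (R : realType) (n : nat) (X : 'I_n -> ptopologicalType).
Context (kappa : forall i : 'I_n,
  R.-pker subprod X (past i) ~> subprod X (future i)).
Local Notation K := (mart_kernel kappa).

Lemma mem_past (i j : 'I_n) : (j \in past i) = (j < i)%N.
Proof. by rewrite /past finset.inE. Qed.

Lemma mem_future (i j : 'I_n) : (j \in future i) = (i <= j)%N.
Proof. by rewrite /future finset.inE. Qed.

Lemma past_setC (i : 'I_n) : past i = ~: future i.
Proof.
by apply/setP => j; rewrite finset.in_setC mem_past mem_future -ltnNge.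
Qed.

Lemma mart_kernel_lift (i : 'I_n) : K (lift ord_max i) = kfreeze (kappa i).
Proof. by rewrite /mart_kernel liftK. Qed.

Lemma kernel_fun_max (F : prodspace X -> R) :
  measurable_fun [set: prodspace X] F -> kernel_fun (K ord_max) F = F.
Proof.
move=> mF; apply/funext => x; rewrite /kernel_fun /mart_kernel unlift_none.
rewrite /Rintegral integral_dirac//=; last exact/measurable_EFinP.
by rewrite indicT mul1r.
Qed.

Lemma kernel_fun_lift (i : 'I_n) (F : prodspace X -> R) x :
  bounded_measurable F -> kernel_fun (K (lift ord_max i)) F x =
  \int[kappa i (restr (past i) x)]_y F (glue (future i) x y).
Proof.
by move=> bF; rewrite /kernel_fun mart_kernel_lift Rintegral_kfreeze.
Qed.

Lemma splice_glue (i : 'I_n) (x : prodspace X) (y : subprod X (future i)) :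
  splice i x (glue (future i) x y) = glue (future i) x y.
Proof.
apply/functional_extensionality_dep => j; rewrite /splice; case: ifP => // ji.
by rewrite glue_notin// mem_future -ltnNge.
Qed.

(** Below the last index, the glued points already carry the first [i] coordinates of [x], so
    splicing leaves them alone; the last kernel is the point mass at [x]. *)
Lemma kernel_fun_splice (i : 'I_n.+1) (F : prodspace X -> R) x :
  bounded_measurable F ->
  kernel_fun (K i) F x = kernel_fun (K i) (fun y => F (splice i x y)) x.
Proof.
move=> bF; have [mF _] := bF.
have bFs := bounded_measurable_comp (measurable_splice i x) bF.
have [mFs _] := bFs.
case: (unliftP ord_max i) bFs mFs => [j ->|->] bFs mFs.
  rewrite !kernel_fun_lift//; apply: eq_Rintegral => y _.
  by rewrite lift_max splice_glue.
by rewrite !kernel_fun_max//= splice_full.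
Qed.

Lemma kernel_fun_past (i : 'I_n.+1) (F : prodspace X -> R)
    (x x' : prodspace X) : bounded_measurable F ->
  (forall j : 'I_n, (j < i)%N -> x j = x' j) ->
  kernel_fun (K i) F x = kernel_fun (K i) F x'.
Proof.
move=> bF; have [mF _] := bF.
case: (unliftP ord_max i) => [j ->|->] xx'.
  rewrite lift_max in xx'; rewrite !kernel_fun_lift//.
  have -> : restr (past j) x = restr (past j) x'.
    apply/functional_extensionality_dep => -[k kj].
    by apply: xx'; rewrite -mem_past.
  apply: eq_Rintegral => y _; congr F; apply/functional_extensionality_dep => k.
  have [kj|kj] := boolP (k \in future j); first by rewrite !glue_in.
  by rewrite !glue_notin//; apply: xx'; rewrite ltnNge -mem_future.
rewrite !kernel_fun_max//; congr F; apply/functional_extensionality_dep => k.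
by apply: xx' => /=.
Qed.

Lemma kernel_fun_bounded_measurable (i : 'I_n.+1) (F : prodspace X -> R) :
  bounded_measurable F -> bounded_measurable (kernel_fun (K i) F).
Proof. exact: bounded_measurable_kernel. Qed.

(** Taking out what is known: after splicing, [h] is the constant [h x] under the integral. *)
Lemma kernel_fun_pull (i : 'I_n.+1) (F h : prodspace X -> R) x :
  bounded_measurable F -> bounded_measurable h ->
  (forall y, h (splice i x y) = h x) ->
  kernel_fun (K i) (fun y => F y * h y) x = kernel_fun (K i) F x * h x.
Proof.
move=> bF bh hs; rewrite kernel_fun_splice; last exact: bounded_measurableM.
under eq_fun do rewrite hs.
rewrite [in RHS]kernel_fun_splice// /kernel_fun RintegralZr//.
apply/bounded_measurable_integrable; first exact: prob_kernel.
exact: bounded_measurable_comp (measurable_splice i x) bF.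
Qed.

Context (mu : probability (prodspace X) R).
Hypothesis kappa_law : forall i, cond_law mu (kappa i).

(** Each kernel preserves [mu]: by [mixture_kfreeze] for the freezing kernels, trivially for the
    identity. *)
Lemma Rintegral_kernel_fun (i : 'I_n.+1) (F : prodspace X -> R) :
  bounded_measurable F ->
  \int[mu]_x kernel_fun (K i) F x = \int[mu]_x F x.
Proof.
move=> bF; have [mF _] := bF.
case: (unliftP ord_max i) => [j ->|->]; last by rewrite kernel_fun_max.
rewrite /kernel_fun mart_kernel_lift -Rintegral_mixture// /Rintegral.
congr fine; apply: eq_measure_integral => A mA _.
by apply: mixture_kfreeze => //; exact: past_setC.
Qed.

End mart_kernel.

(** * The martingale property and the moment generating function *)

(** [lift ord_max i] and [lift ord0 i] have values [i] and [i + 1]: they index consecutive kernels,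
    and [i] is the coordinate revealed between them. *)
Lemma ord_succ_ind (n : nat) (P : 'I_n.+1 -> Prop) : P ord0 ->
  (forall i : 'I_n, P (lift ord_max i) -> P (lift ord0 i)) -> forall i, P i.
Proof.
move=> P0 PS [k kn]; elim: k kn => [|k IH] kn.
  by rewrite (_ : Ordinal kn = ord0)//; exact: val_inj.
rewrite (_ : Ordinal kn = lift ord0 (Ordinal (kn : k < n)%N));
  last exact: val_inj.
apply: PS; rewrite (_ : lift _ _ = Ordinal (ltnW kn))//.
by apply: val_inj; exact: lift_max.
Qed.

Section martingale.
Context (R : realType) (n : nat) (X : 'I_n -> ptopologicalType).
Context (kappa : forall i : 'I_n,
  R.-pker subprod X (past i) ~> subprod X (future i)).
Context (mu : probability (prodspace X) R).
Hypothesis kappa_law : forall i, cond_law mu (kappa i).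
Local Notation K := (mart_kernel kappa).

Let mu1 := probability_setT mu.

(** The defining property of conditional expectation given the first [i] coordinates; it combines
    [kernel_fun_pull] with the invariance of [mu]. *)
Lemma Rintegral_kernel_funM (i : 'I_n.+1) (F h : prodspace X -> R) :
  bounded_measurable F -> bounded_measurable h ->
  (forall x y : prodspace X, (forall j : 'I_n, (j < i)%N -> x j = y j) ->
    h x = h y) ->
  \int[mu]_x (kernel_fun (K i) F x * h x) = \int[mu]_x (F x * h x).
Proof.
move=> bF bh hp; rewrite -[RHS](Rintegral_kernel_fun kappa_law i).
  apply: eq_Rintegral => x _; rewrite kernel_fun_pull// => y.
  by apply: hp => j ji; rewrite /splice ji.
exact: bounded_measurableM.
Qed.

(** Hoeffding's lemma applied conditionally: under [K i x] the mean of [G] is [h x], and invariance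
    of [mu] allows [K i] to be inserted under the outer integral. *)
Lemma kernel_fun_mgf_step (i : 'I_n.+1) (G : prodspace X -> R) (c l E : R) :
  bounded_measurable G ->
  (forall x y : prodspace X, (forall j : 'I_n, (j < i)%N -> x j = y j) ->
    G x - G y <= c) ->
  \int[mu]_x expR (l * (G x - E)) <=
  expR (l ^+ 2 * c ^+ 2 / 8) *
    \int[mu]_x expR (l * (kernel_fun (K i) G x - E)).
Proof.
move=> bG Gc; set h := kernel_fun (K i) G.
have bh : bounded_measurable h by exact: kernel_fun_bounded_measurable.
have bexp F : bounded_measurable F ->
    bounded_measurable (fun x : prodspace X => expR (l * (F x - E))).
  exact: bounded_measurable_exp_centered.
rewrite -RintegralZl//; last exact/(bounded_measurable_integrable mu1)/bexp.
rewrite -(Rintegral_kernel_fun kappa_law i); last exact: bexp.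
apply: le_Rintegral => //.
- exact/(bounded_measurable_integrable mu1)/kernel_fun_bounded_measurable/bexp.
- apply/(bounded_measurable_integrable mu1)/bounded_measurableM;
    last exact: bexp.
  exact: bounded_measurable_cst.
move=> x _; have Kx1 := prob_kernel (s := K i) x.
(* Spliced points agree before [i], so [Gc] bounds the oscillation of [phi] over all pairs, as
   [hoeffding_mgf] requires. *)
pose phi y := G (splice i x y).
have bphi : bounded_measurable phi.
  exact: bounded_measurable_comp (measurable_splice i x) bG.
have phih : \int[K i x]_y phi y = h x by rewrite /h kernel_fun_splice.
rewrite kernel_fun_splice; last exact: bounded_measurable_exp_centered.
rewrite /kernel_fun.
have -> : (fun y => expR (l * (G (splice i x y) - E))) =
    (fun y => expR (l * (phi y - h x)) * expR (l * (h x - E))).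
  by apply/funext => y; rewrite -expRD -mulrDr addrA subrK.
rewrite RintegralZr//; last first.
  exact/(bounded_measurable_integrable Kx1)/bounded_measurable_exp_centered.
rewrite ler_wpM2r ?expR_ge0// -phih; apply: hoeffding_mgf => // y z.
by apply: Gc => j ji; rewrite /splice ji.
Qed.

Variables (f : prodspace X -> R) (bf : bounded_measurable f).
Local Notation g i := (kernel_fun (K i) f).

Let bg (i : 'I_n.+1) : bounded_measurable (g i).
Proof. exact: kernel_fun_bounded_measurable. Qed.

(** The equality is only almost everywhere, since the versions [kappa i] are fixed separately for
    each [i]. The difference [D] of the two sides is shown to have zero second moment. *)
Lemma kernel_fun_tower (i : 'I_n) :
  ae_eq mu setT (EFin \o kernel_fun (K (lift ord_max i)) (g (lift ord0 i)))
    (EFin \o g (lift ord_max i)).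
Proof.
set a := lift ord_max i; set b := lift ord0 i.
pose D x := g a x - kernel_fun (K a) (g b) x.
have bKg : bounded_measurable (kernel_fun (K a) (g b)).
  exact: kernel_fun_bounded_measurable.
have bD : bounded_measurable D by exact: bounded_measurableB.
have Dpast x y : (forall j : 'I_n, (j < i)%N -> x j = y j) -> D x = D y.
  by move=> xy; congr (_ - _); apply: kernel_fun_past => // j;
    rewrite /a lift_max; exact: xy.
(* D depends on the past of i only, hence can be moved through the kernels:
   both terms of D are versions of the conditional expectation of f. *)
have DD0 : \int[mu]_x (D x * D x) = 0.
  under eq_Rintegral do rewrite [X in X * _]/D mulrBl.
  rewrite RintegralB//;
    [|exact/(bounded_measurable_integrable mu1)/bounded_measurableM..].
  apply/eqP; rewrite subr_eq0; apply/eqP.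
  rewrite !Rintegral_kernel_funM//.
  - by move=> x y xy; apply: Dpast => j ji; apply: xy; rewrite lift0 ltnW.
  - by move=> x y xy; apply: Dpast => j ji; apply: xy;
      move: ji; rewrite lift_max.
  - by move=> x y xy; apply: Dpast => j ji; apply: xy;
      move: ji; rewrite lift_max.
have bDD := bounded_measurableM bD bD.
have [mDD _] := bDD.
have mDDE : measurable_fun [set: prodspace X] (EFin \o (fun z => D z * D z)).
  exact/measurable_EFinP.
have /(ae_eq_integral_abs _ measurableT mDDE) :
    (\int[mu]_x `|(EFin \o (fun z => D z * D z)%R) x| = 0)%E.
  under eq_integral do rewrite /= ger0_norm ?sqr_ge0//.
  by rewrite -(EFin_Rintegral mu1)// DD0.
apply: filterS => x /= /(_ I)[] DDx _.
by move/eqP: DDx; rewrite mulf_eq0 orbb subr_eq0 => /eqP ->.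
Qed.

(** Induction on [i], one Hoeffding factor per revealed coordinate. [kernel_fun_mgf_step] leaves a
    kernel applied to the next [g], which [kernel_fun_tower] turns into the current one; almost
    everywhere equality suffices under the integral. *)
Lemma kernel_fun_mgf (c : 'I_n -> R) (l : R) :
  (forall (i : 'I_n) (x y : prodspace X),
    (forall j : 'I_n, (j < i)%N -> x j = y j) ->
    g (lift ord0 i) x - g (lift ord0 i) y <= c i) ->
  forall i : 'I_n.+1, \int[mu]_x expR (l * (g i x - \int[mu]_y f y)) <=
    expR (l ^+ 2 * (\sum_(j < n | (j < i)%N) c j ^+ 2) / 8).
Proof.
move=> gc; set E := \int[mu]_y f y.
apply: ord_succ_ind => [|i IH].
  (* No coordinate precedes index 0, so [g ord0] is constant, and invariance of [mu] identifies the
     constant. *)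
  have g0 x : g ord0 x = E.
    rewrite /E -(Rintegral_kernel_fun kappa_law ord0)//.
    rewrite -[LHS](Rintegral_probability_cst mu1).
    by apply: eq_Rintegral => y _; exact: kernel_fun_past.
  under eq_Rintegral do rewrite g0 subrr mulr0 expR0.
  by rewrite (Rintegral_probability_cst mu1) big_pred0// mulr0 mul0r expR0.
have -> : \sum_(j < n | (j < lift ord0 i)%N) c j ^+ 2 =
    c i ^+ 2 + \sum_(j < n | (j < lift ord_max i)%N) c j ^+ 2.
  rewrite (bigD1 i) ?lift0//; congr (_ + _); apply: eq_bigl => j.
  by rewrite lift_max ltnS ltn_neqAle andbC.
rewrite mulrDr mulrDl expRD.
have osc x y : (forall j : 'I_n, (j < lift ord_max i)%N -> x j = y j) ->
    g (lift ord0 i) x - g (lift ord0 i) y <= c i.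
  by rewrite lift_max; exact: gc.
apply: (le_trans (kernel_fun_mgf_step l E (bg _) osc)).
apply: ler_wpM2l; first exact: expR_ge0.
apply: le_trans IH; rewrite le_eqVlt.
apply/orP; left; apply/eqP; apply: ae_eq_Rintegral.
- by case: (bounded_measurable_exp_centered l E
    (kernel_fun_bounded_measurable kappa (lift ord_max i) (bg (lift ord0 i)))).
- by case: (bounded_measurable_exp_centered l E (bg (lift ord_max i))).
by apply: filterS (kernel_fun_tower i) => x /= /(_ I)[] <-.
Qed.

End martingale.

(** * Local oscillations and Lipschitz functions *)

Section oscillation.
Context (R : realType) (n : nat) (X : 'I_n -> ptopologicalType).
Context (rho : forall i, X i -> X i -> R).
Hypothesis metric_rho : forall i, is_metric (@rho i).
Implicit Types (f : prodspace X -> R).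

(** Going from [x] to [y] and back gives [0 <= 2 rho x y]. *)
Lemma metric_ge0 i (x y : X i) : 0 <= rho x y.
Proof.
have [rho0 rhoC rhoD] := metric_rho i.
by have := rhoD x y x; rewrite (rhoC y x) (rho0 x x).2// -mulr2n pmulrn_lge0.
Qed.

Lemma rho_sum_eq_off (i : 'I_n) (x z : prodspace X) :
  (forall j, j != i -> x j = z j) -> rho_sum rho x z = rho (x i) (z i).
Proof.
move=> xz; rewrite /rho_sum (bigD1 i)//= big1 ?addr0// => j ji.
by have [rho0 _ _] := metric_rho j; apply/rho0; exact: xz.
Qed.

Lemma local_osc_ge0 f i : (0 <= local_osc rho f i)%E.
Proof.
(* A diagonal pair contributes [0 / 0 = 0] to the supremum. *)
apply: ereal_sup_ubound; exists (point, point) => //=.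
by rewrite subrr normr0 mul0r.
Qed.

(** For points that differ at [i] only, [rho_sum] reduces to [rho] at [i]. The absolute value is
    there because [L] may be negative. *)
Lemma local_osc_lipschitz f i L :
  (forall x z, `|f x - f z| <= L * rho_sum rho x z) ->
  (local_osc rho f i <= `|L|%:E)%E.
Proof.
move=> fL; apply: ge_ereal_sup => _ [[x z] /= xz <-]; rewrite lee_fin.
have := fL x z; rewrite (rho_sum_eq_off xz) => fxz.
have [r0|r0] := eqVneq (rho (x i) (z i)) 0; first by rewrite r0 invr0 mulr0.
rewrite ler_pdivrMr ?lt_def ?r0 ?metric_ge0//; apply: (le_trans fxz).
by rewrite ler_wpM2r ?metric_ge0// ler_norm.
Qed.

Lemma local_osc_le f i C (x z : prodspace X) : (local_osc rho f i <= C%:E)%E ->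
  (forall j, j != i -> x j = z j) -> `|f x - f z| <= C * rho (x i) (z i).
Proof.
move=> fC xz; have [r0|r0] := eqVneq (rho (x i) (z i)) 0.
  have [rho0 _ _] := metric_rho i.
  have -> : x = z.
    apply/functional_extensionality_dep => j.
    by have [->|/xz//] := eqVneq j i; exact/rho0.
  by rewrite subrr normr0 (rho0 _ _).2// mulr0.
rewrite -ler_pdivrMr ?lt_def ?r0 ?metric_ge0// -lee_fin; apply: le_trans fC.
by apply: ereal_sup_ubound; exists (x, z).
Qed.

Hypothesis rho_bounded : forall i, (rho_norm rho i < +oo)%E.

Lemma rho_le_norm i (x z : X i) : ((rho x z)%:E <= rho_norm rho i)%E.
Proof. by apply: ereal_sup_ubound; exists (x, z). Qed.

Lemma rho_norm_fin_num i : rho_norm rho i \is a fin_num.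
Proof.
rewrite ge0_fin_numE ?rho_bounded//.
have := rho_le_norm (point : X i) point; apply: le_trans.
by rewrite lee_fin metric_ge0.
Qed.

Lemma rho_le_fine_norm i (x z : X i) : rho x z <= fine (rho_norm rho i).
Proof. by rewrite -lee_fin fineK ?rho_norm_fin_num// rho_le_norm. Qed.

(** [rho_sum] is at most the sum of the finite diameters, so a Lipschitz function stays within a
    fixed distance of its value at [point]. *)
Lemma lipschitz_bounded_measurable f : measurable_fun [set: prodspace X] f ->
  rho_lipschitz rho f -> bounded_measurable f.
Proof.
move=> mf [L fL]; split => //.
exists (`|f point| + `|L| * \sum_(i < n) fine (rho_norm rho i)) => x.
rewrite -[f x](subrK (f point)) addrC (le_trans (ler_normD _ _))// lerD2l.
apply: (le_trans (fL _ _)); apply: (@le_trans _ _ (`|L| * rho_sum rho x point)).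
  by rewrite ler_wpM2r ?ler_norm// sumr_ge0// => i _; exact: metric_ge0.
by rewrite ler_wpM2l// ler_sum// => i _; exact: rho_le_fine_norm.
Qed.

Lemma local_osc_fin_num f i : rho_lipschitz rho f ->
  local_osc rho f i \is a fin_num.
Proof.
move=> [L fL]; rewrite ge0_fin_numE ?local_osc_ge0//.
exact: le_lt_trans (local_osc_lipschitz i fL) (ltry _).
Qed.

End oscillation.

(** * Sub-Gaussian tails from Chernoff's inequality *)

Section chernoff.
Context d (T : measurableType d) (R : realType).
Variable m : probability T R.

Lemma subgaussian_tail (Y : T -> R) (S t : R) : bounded_measurable Y ->
  (forall l, \int[m]_x expR (l * Y x) <= expR (l ^+ 2 * S / 8)) ->
  0 <= S -> 0 <= t ->
  (m [set x | t <= Y x]%R <= expeR (- ((2 * t ^+ 2)%:E / S%:E)))%E.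
Proof.
move=> bY mgf S0 t0.
have tail l : 0 <= l ->
    (m [set x | t <= Y x]%R <= (expR (l ^+ 2 * S / 8 - l * t))%:E)%E.
  have [mY _] := bY; rewrite le_eqVlt => /predU1P[<-|l0].
    rewrite expr0n/= !mul0r subrr expR0.
    exact/probability_le1/measurable_superlevel.
  pose Z : {RV m >-> R} := mfun_Sub (mem_set mY).
  apply: (le_trans (chernoff Z t l0)).
  rewrite /mmt_gen_fun unlock.
  have -> : expR \o l \o* Z = (fun x => expR (l * Y x)).
    by apply/funext => x /=; rewrite mulrC.
  rewrite -(EFin_Rintegral (probability_setT m)).
    by rewrite -EFinM lee_fin expRD ler_wpM2r ?expR_ge0.
  have := bounded_measurable_exp_centered l 0 bY.
  by under eq_fun do rewrite subr0.
move: S0; rewrite le_eqVlt => /predU1P[S0|S0]; last first.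
  (* This [l] minimises [l^2 S / 8 - l t]; the minimum is [- 2 t^2 / S]. *)
  have l0 : 0 <= 4 * t / S by rewrite divr_ge0 ?mulr_ge0// ltW.
  apply: (le_trans (tail _ l0)).
  rewrite inver gt_eqF// -EFinM -EFinN/= lee_fin ler_expR le_eqVlt.
  by apply/orP; left; apply/eqP; field; rewrite gt_eqF.
(* Division by S = 0 gives +oo, so that the bound is 0 as soon as t > 0. *)
rewrite -S0 in tail *; rewrite inve0.
move: t0; rewrite le_eqVlt => /predU1P[t0|t0].
  (* For [t = 0] the exponent is [0 * +oo = 0], so the bound is 1. *)
  rewrite -t0 in tail *; rewrite expr0n/= mulr0 mul0e oppe0 expeR0.
  by have := tail 0 (lexx _); rewrite expr0n/= !mul0r subrr expR0.
rewrite mulry gtr0_sg ?mulr_gt0 ?exprn_gt0// mul1e /=.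
set p := m _; have p0 : (0 <= p)%E by exact: measure_ge0.
have pfin : p \is a fin_num.
  by rewrite ge0_fin_numE// (le_lt_trans (tail 0 (lexx _)))// ltry.
rewrite leNgt; apply/negP; rewrite -[p]fineK// lte_fin => {}p0.
(* If [p > 0], taking [l = 1 / (p t)] gives [p <= exp (- 1 / p)], against
   [exp (1 / p) >= 1 + 1 / p]. *)
have /tail : 0 <= (fine p)^-1 / t by rewrite divr_ge0 ?invr_ge0// ltW.
rewrite -/p -[leLHS]fineK// lee_fin mulr0 mul0r add0r divfK ?gt_eqF// expRN.
apply/negP; rewrite -ltNge invf_plt ?posrE ?expR_gt0//.
by apply: lt_le_trans (expR_ge1Dx _); rewrite ltrDr.
Qed.

End chernoff.

(** * Martingale increments and the two-sided concentration bound *)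

(** The kernel of index [i + 1] reads coordinates up to and including [i]. Hence [y] may be replaced
    by the hybrid [z], which differs from [x] at [i] alone, and the local oscillation at [i] times
    the diameter bounds the increment. *)
Lemma kernel_fun_osc (R : realType) (n : nat) (X : 'I_n -> ptopologicalType)
    (rho : forall i, X i -> X i -> R)
    (metric_rho : forall i, is_metric (rho i))
    (rho_bounded : forall i, (rho_norm rho i < +oo)%E)
    (kappa : forall i : 'I_n,
      R.-pker subprod X (past i) ~> subprod X (future i))
    (f : prodspace X -> R) (i : 'I_n) (C : R) (x y : prodspace X) :
  bounded_measurable f -> 0 <= C ->
  (local_osc rho (kernel_fun (mart_kernel kappa (lift ord0 i)) f) i <=
    C%:E)%E ->
  (forall j : 'I_n, (j < i)%N -> x j = y j) ->
  kernel_fun (mart_kernel kappa (lift ord0 i)) f x -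
    kernel_fun (mart_kernel kappa (lift ord0 i)) f y <=
  fine (rho_norm rho i) * C.
Proof.
move=> bf C0 oscC xy.
pose z : prodspace X := fun j => if j == i then y j else x j.
have xz j : j != i -> x j = z j by rewrite /z => /negbTE ->.
have -> : kernel_fun (mart_kernel kappa (lift ord0 i)) f y =
          kernel_fun (mart_kernel kappa (lift ord0 i)) f z.
  apply: kernel_fun_past => // j; rewrite lift0 ltnS leq_eqVlt /z.
  by rewrite val_eqE; case: eqVneq => //= _ /xy.
apply: (le_trans (ler_norm _)).
apply: (le_trans (local_osc_le metric_rho oscC xz)).
by rewrite mulrC ler_wpM2r// rho_le_fine_norm.
Qed.

Theorem theorem4p2 (R : realType) (n : nat) (X : 'I_n -> ptopologicalType)
    (polishX : forall i, polish R (X i))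
    (rho : forall i, X i -> X i -> R)
    (metric_rho : forall i, is_metric (rho i))
    (measurable_rho : forall i,
      measurable_fun [set: borel (X i) * borel (X i)]
        (fun p : borel (X i) * borel (X i) => rho i p.1 p.2))
    (mu : probability (prodspace X) R)
    (kappa : forall i : 'I_n,
      R.-pker subprod X (past i) ~> subprod X (future i))
    (kappa_law : forall i, cond_law mu (kappa i))
    (rho_bounded : forall i, (rho_norm rho i < +oo)%E)
    (V : 'I_n.+1 -> 'M[R]_n)
    (wassersteinV : forall i, wasserstein_matrix rho (mart_kernel kappa i) (V i))
    (d : measure_display) (Omega : measurableType d) (P : probability Omega R)
    (xi : {RV P >-> prodspace X})
    (law_xi : forall A : set (prodspace X),
      measurable A -> distribution P xi A = mu A)
    (f : prodspace X -> R)
    (measurable_f : measurable_fun [set: prodspace X] f)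
    (lipschitz_f : rho_lipschitz rho f)
    (t : R) (t_ge0 : 0 <= t) :
  (P [set w | t%:E <= `| (f (xi w))%:E - 'E_P[f \o xi] |] <=
   2%:E * expeR (- ((2 * t ^+ 2)%:E /
      l2norm_sq (mulmxv (Gamma rho V) (local_osc rho f)))))%E.
Proof.
have bf := lipschitz_bounded_measurable metric_rho rho_bounded measurable_f
  lipschitz_f.
have mu1 := probability_setT mu.
pose o j := fine (local_osc rho f j).
have oE j : local_osc rho f j = (o j)%:E.
  by rewrite fineK// (local_osc_fin_num metric_rho).
(* [C i] is the Wasserstein bound on the oscillation at [i] of the kernel of index [i + 1] applied
   to [f]; [c i] below is the entry at [i] of [Gamma] times the oscillation vector. *)
pose C (i : 'I_n) := \sum_(j < n) V (lift ord0 i) i j * o j.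
have C0 i : 0 <= C i.
  apply: sumr_ge0 => j _; rewrite mulr_ge0 ?fine_ge0 ?local_osc_ge0//.
  by case: (wassersteinV (lift ord0 i)) => + _; apply.
pose c i := fine (rho_norm rho i) * C i.
have cE i : mulmxv (Gamma rho V) (local_osc rho f) i = (c i)%:E.
  rewrite /mulmxv /Gamma -(fineK (rho_norm_fin_num metric_rho rho_bounded i)).
  under eq_bigr do rewrite oE -!EFinM -mulrA.
  by rewrite sumEFin -mulr_sumr.
have -> : l2norm_sq (mulmxv (Gamma rho V) (local_osc rho f)) =
    (\sum_(i < n) c i ^+ 2)%:E.
  rewrite /l2norm_sq; under eq_bigr do rewrite cE -EFin_expe.
  by rewrite sumEFin.
set S := \sum_(i < n) c i ^+ 2; set E := \int[mu]_x f x.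
have mgf l : \int[mu]_x expR (l * (f x - E)) <= expR (l ^+ 2 * S / 8).
  (* At [ord_max] the kernel is the identity and every coordinate is below [n], so the bound
     concerns [f] itself and the full sum. *)
  have := kernel_fun_mgf kappa_law bf l (c := c) _ ord_max.
  rewrite kernel_fun_max// (eq_bigl xpredT) => [|j]; last exact: ltn_ord.
  apply => i x y; apply: kernel_fun_osc => //.
  have [_ /(_ f measurable_f lipschitz_f i)] := wassersteinV (lift ord0 i).
  by under eq_bigr do rewrite oE -EFinM; rewrite sumEFin.
have PE : ('E_P[f \o xi] = E%:E)%E.
  rewrite unlock EFin_Rintegral//.
  rewrite -(@eq_measure_integral _ _ _ _ _ (distribution P xi)); last first.
    by move=> A mA _; exact: law_xi.
  rewrite integral_distribution//; first exact/measurable_EFinP.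
  apply: (bounded_measurable_integrable (probability_setT P)).
  by apply: bounded_measurable_comp bf; exact: measurable_funPT.
pose Y x := f x - E; pose Z x := E - f x.
have bE : bounded_measurable (fun _ : prodspace X => E).
  exact: bounded_measurable_cst.
have bY : bounded_measurable Y by exact: bounded_measurableB.
have bZ : bounded_measurable Z by exact: bounded_measurableB.
have -> : P [set w | (t%:E <= `| (f (xi w))%:E - 'E_P[f \o xi] |)%E] =
    mu ([set x | t <= Y x] `|` [set x | t <= Z x]).
  rewrite -law_xi; last by apply: measurableU; apply: measurable_superlevel;
    [case: bY|case: bZ].
  rewrite /distribution /pushforward PE; congr (P _).
  apply/seteqP; split => w; rewrite /= lee_fin ler_normr opprB.
    by move/orP.
  by move=> h; apply/orP.
have S0 : 0 <= S by apply: sumr_ge0 => i _; exact: sqr_ge0.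
apply: (le_trans (measureU2 _ _ _)); [by apply: measurable_superlevel; case: bY|
  by apply: measurable_superlevel; case: bZ|].
rewrite -[2%:E]/(1 + 1)%:E EFinD ge0_muleDl// mul1e; apply: leeD.
  by apply: subgaussian_tail.
(* The lower tail uses the same bound at [- l], which is even in [l]. *)
apply: subgaussian_tail => // l; have := mgf (- l).
rewrite sqrrN; apply: le_trans; rewrite le_eqVlt; apply/orP; left; apply/eqP.
by apply: eq_Rintegral => x _; rewrite mulNr -mulrN opprB.
Qed.
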